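(* For $A,B\in\mathrm{End}(V)$, $\dim V=m$, the quantity $\langle A,B\rangle=-\,b\circ(A\otimes B-B\otimes A)$ is a cocycle on the Lie algebra $gl(m)$, i.e. $$\langle A,[B,C]\rangle+\langle B,[C,A]\rangle+\langle C,[A,B]\rangle=0\qquad\forall\,A,B,C\in gl(m).$$ It reduces to the Lie algebra $sl(m)$ (i.e. it restricts to a cocycle on $sl(m)$).
   Context: $gl(m)$ is identified with $\mathrm{End}(V)$, $\dim V=m$, over $\mathbb K=\mathbb C$ (or $\mathbb R$), with matrix units $e_i^j$, $e_i^j\circ e_k^s=\delta_k^je_i^s$; $\circ$ is the product of operators (also applied to $\mathrm{End}(V)^{\otimes2}$), and $\mathrm{Tr}$ is the usual trace. The operation $b\circ$ on skew-symmetric tensors is (the skew-symmetrized linear term, at $q=1$, of the deformation of the pairing $A\otimes B\mapsto\mathrm{Tr}(A\circ B)$ in the case of the standard $U_q(sl(m))$ Hecke symmetry) given by $$b\circ(A\otimes B-B\otimes A)=\mathrm{Tr}\circ\big(-r_-^{\mathrm{ad,ad}}(A\otimes B)-r_+^{\mathrm{r,l}}(A\otimes B)+r_+^{\mathrm{l,r}}(A\otimes B)\big),$$ where, with $e\triangleright A=e\circ A$, $A\triangleleft e=A\circ e$, $\mathrm{ad}\,e(A)=e\circ A-A\circ e$, $$r_-^{\mathrm{ad,ad}}(A\otimes B)=\sum_{i<j}\big(\mathrm{ad}\,e_i^j(A)\otimes\mathrm{ad}\,e_j^i(B)-\mathrm{ad}\,e_j^i(A)\otimes\mathrm{ad}\,e_i^j(B)\big),$$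 $$r_+^{\mathrm{l,r}}(A\otimes B)=\sum_{i,j}(e_i^j\triangleright A)\otimes(B\triangleleft e_j^i),\qquad r_+^{\mathrm{r,l}}(A\otimes B)=\sum_{i,j}(A\triangleleft e_i^j)\otimes(e_j^i\triangleright B),$$ and $\mathrm{Tr}\circ(X\otimes Y)=\mathrm{Tr}(X\circ Y)$. *)

(* Defs.v *)
From HB Require Import structures.
From mathcomp Require Import all_boot all_order all_algebra.

Set Implicit Arguments.
Unset Strict Implicit.
Unset Printing Implicit Defensive.

Import Order.TTheory GRing.Theory Num.Theory.
Local Open Scope ring_scope.

(* The field K is any numFieldType, which covers both the real and the        *)
(* complex numbers; End(V) is 'M[K]_m, and the matrix unit e_i^j is           *)
(* delta_mx i j, so that e_i^j o e_k^s = delta_k^j e_i^s.                     *)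

Section TensorSquare.
Variables (K : numFieldType) (m : nat).
Implicit Types (A B : 'M[K]_m) (f g : 'M[K]_m -> 'M[K]_m).

(* End(V)^{(x)2} is modelled by square matrices of size dim End(V) = m * m:   *)
(* the entry (a, b) is the coefficient on the a-th and b-th matrix units in   *)
(* the enumeration fixed by mxvec.                                            *)
Definition tens A B : 'M[K]_(m * m) := (mxvec A)^T *m mxvec B.

(* f (x) g acting on the tensor square, for linear f and g; see tens_mapE.    *)
Definition tens_map f g (T : 'M[K]_(m * m)) : 'M[K]_(m * m) :=
  (lin_mx f)^T *m T *m lin_mx g.

(* The linear extension of A (x) B |-> Tr (A o B); see tens_trE.              *)
Definition tens_tr (T : 'M[K]_(m * m)) : K :=
  \sum_a \sum_b T a b *
    \tr (vec_mx (delta_mx 0 a) *m vec_mx (delta_mx 0 b) : 'M[K]_m).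

Definition mxad (e : 'M[K]_m) A : 'M[K]_m := e *m A - A *m e.

Definition r_minus_ad_ad (T : 'M[K]_(m * m)) : 'M[K]_(m * m) :=
  \sum_(i < m) \sum_(j < m | (i < j)%N)
    (tens_map (mxad (delta_mx i j)) (mxad (delta_mx j i)) T
     - tens_map (mxad (delta_mx j i)) (mxad (delta_mx i j)) T).

Definition r_plus_l_r (T : 'M[K]_(m * m)) : 'M[K]_(m * m) :=
  \sum_(i < m) \sum_(j < m)
    tens_map (mulmx (delta_mx i j)) (mulmxr (delta_mx j i)) T.

Definition r_plus_r_l (T : 'M[K]_(m * m)) : 'M[K]_(m * m) :=
  \sum_(i < m) \sum_(j < m)
    tens_map (mulmxr (delta_mx i j)) (mulmx (delta_mx j i)) T.

(* The defining property of the operation b.  It determines b on the          *)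
(* skew-symmetric tensors, which the A (x) B - B (x) A span, and leaves it    *)
(* free on a complement; such a b exists by is_b_exists.                      *)
Definition is_b (b : {linear 'M[K]_(m * m) -> K^o}) : Prop :=
  forall A B, b (tens A B - tens B A) =
    tens_tr (- r_minus_ad_ad (tens A B) - r_plus_r_l (tens A B)
             + r_plus_l_r (tens A B)).

Definition pairing (b : {linear 'M[K]_(m * m) -> K^o}) A B : K :=
  - b (tens A B - tens B A).

Definition lie A B : 'M[K]_m := A *m B - B *m A.

Definition gl : {vspace 'M[K]_m} := fullv.

Definition sl : {vspace 'M[K]_m} := lker (linfun (mxtrace : 'M[K]_m -> K^o)).

Definition lie_subalgebra (L : {vspace 'M[K]_m}) : Prop :=
  {in L &, forall A B, lie A B \in L}.

(* w restricted to L is a scalar 2-cocycle of the Lie algebra L.              *)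
Record lie_cocycle (L : {vspace 'M[K]_m}) (w : 'M[K]_m -> 'M[K]_m -> K) :
    Prop := LieCocycle {
  cocycle_linear_l : forall k, {in L & &, forall A B C,
    w (k *: A + B) C = k * w A C + w B C};
  cocycle_linear_r : forall k, {in L & &, forall A B C,
    w A (k *: B + C) = k * w A B + w A C};
  cocycle_skew : {in L &, forall A B, w A B = - w B A};
  cocycle_jacobi : {in L & &, forall A B C,
    w A (lie B C) + w B (lie C A) + w C (lie A B) = 0}
}.

Lemma mem_sl A : (A \in sl) = (\tr A == 0).
Proof. by rewrite memv_ker lfunE. Qed.

Lemma tens_mapE (f g : {linear 'M[K]_m -> 'M[K]_m}) A B :
  tens_map f g (tens A B) = tens (f A) (g B).
Proof.
by rewrite /tens_map /tens mulmxA -trmx_mul -mulmxA !mul_vec_lin.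
Qed.

Lemma tens_trE A B : tens_tr (tens A B) = \tr (A *m B).
Proof.
have E (X : 'M[K]_m) : X = \sum_a mxvec X 0 a *: vec_mx (delta_mx 0 a).
  rewrite -[LHS]mxvecK [mxvec X in LHS]row_sum_delta linear_sum /=.
  by apply: eq_bigr => a _; rewrite linearZ.
rewrite {2}(E A) {2}(E B) mulmx_suml [RHS]linear_sum /=.
apply: eq_bigr => a _; rewrite mulmx_sumr [RHS]linear_sum /=.
apply: eq_bigr => b _.
rewrite -scalemxAl -scalemxAr !linearZ /= mulrA; congr (_ * _).
by rewrite /tens mxE big_ord1 mxE.
Qed.

Fact tens_tr_is_linear : linear (tens_tr : 'M[K]_(m * m) -> K^o).
Proof.
move=> k S T; rewrite /tens_tr /GRing.scale /= mulr_sumr -big_split /=.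
apply: eq_bigr => a _; rewrite mulr_sumr -big_split /=.
by apply: eq_bigr => b _; rewrite !mxE mulrDl mulrA.
Qed.

HB.instance Definition _ :=
  GRing.isLinear.Build K 'M[K]_(m * m) K^o _ tens_tr tens_tr_is_linear.

Fact mxad_is_linear e : linear (mxad e).
Proof.
move=> k A B; rewrite /mxad linearP mulmxDl -scalemxAl scalerBr.
by rewrite addrACA opprD.
Qed.

HB.instance Definition _ e :=
  GRing.isLinear.Build K 'M[K]_m 'M[K]_m _ (mxad e) (mxad_is_linear e).

Fact tens_map_is_linear f g : linear (tens_map f g).
Proof.
by move=> k S T; rewrite /tens_map mulmxDr mulmxDl -scalemxAr -scalemxAl.
Qed.

HB.instance Definition _ f g :=
  GRing.isLinear.Build K 'M[K]_(m * m) 'M[K]_(m * m) _ (tens_map f g)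
    (tens_map_is_linear f g).

Let b_form (T : 'M[K]_(m * m)) : K^o :=
  tens_tr (- r_minus_ad_ad T - r_plus_r_l T + r_plus_l_r T).

Let b_form_linear : linear b_form.
Proof.
have lin_minus : linear r_minus_ad_ad.
  move=> k S T; rewrite /r_minus_ad_ad scaler_sumr -big_split /=.
  apply: eq_bigr => i _; rewrite scaler_sumr -big_split /=.
  by apply: eq_bigr => j _; rewrite !linearP scalerDr addrACA.
have lin_lr : linear r_plus_l_r.
  move=> k S T; rewrite /r_plus_l_r scaler_sumr -big_split /=.
  apply: eq_bigr => i _; rewrite scaler_sumr -big_split /=.
  by apply: eq_bigr => j _; rewrite linearP.
have lin_rl : linear r_plus_r_l.
  move=> k S T; rewrite /r_plus_r_l scaler_sumr -big_split /=.
  apply: eq_bigr => i _; rewrite scaler_sumr -big_split /=.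
  by apply: eq_bigr => j _; rewrite linearP.
move=> k S T; apply: etrans (tens_tr_is_linear _ _ _).
apply: (congr1 tens_tr).
rewrite lin_minus lin_lr lin_rl !linearP !scalerDr.
rewrite /= [X in X + _ = _]addrACA [LHS]addrACA; reflexivity.
Qed.

Let b_form_skew A B : b_form (tens B A) = - b_form (tens A B).
Proof.
rewrite /b_form !linearD !linearN /= ?opprK.
have -> : tens_tr (r_minus_ad_ad (tens B A)) =
          - tens_tr (r_minus_ad_ad (tens A B)).
  rewrite /r_minus_ad_ad !linear_sum /= -sumrN; apply: eq_bigr => i _.
  rewrite !linear_sum /= -sumrN; apply: eq_bigr => j _.
  rewrite !linearB /= !tens_mapE !tens_trE opprB.
  by rewrite mxtrace_mulC; congr (_ - _); rewrite mxtrace_mulC.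
have lr A' B' : tens_tr (r_plus_l_r (tens A' B')) =
                tens_tr (r_plus_r_l (tens B' A')).
  rewrite /r_plus_l_r /r_plus_r_l exchange_big !linear_sum /=.
  apply: eq_bigr => i _; rewrite !linear_sum /=; apply: eq_bigr => j _.
  by rewrite !tens_mapE !tens_trE /= -mulmxA mxtrace_mulC !mulmxA.
by rewrite !lr [LHS]addrAC; do 2![apply: (congr2 +%R) => //]; apply: opprK.
Qed.

Lemma is_b_exists : exists b : {linear 'M[K]_(m * m) -> K^o}, is_b b.
Proof.
pose bL : {linear 'M[K]_(m * m) -> K^o} := HB.pack b_form
  (GRing.isLinear.Build K 'M[K]_(m * m) K^o _ b_form b_form_linear).
exists (2^-1 \*: bL) => A B /=.
have -> : b_form (tens A B - tens B A) = 2 * b_form (tens A B).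
  by rewrite -[b_form]/(bL : _ -> _) linearB /= b_form_skew mulr_natl mulr2n;
    congr (_ + _); apply: opprK.
by rewrite /GRing.scale /= mulrA mulVf ?mul1r // pnatr_eq0.
Qed.

End TensorSquare.

(* Main.v *)
(* The two r_+ terms both contribute m Tr(AB) and cancel.  Expanding the      *)
(* r_- term on matrix units leaves                                            *)
(*   <A, B> = \sum_(i < j) ([A, B]_ii - [A, B]_jj),                           *)
(* so the pairing is the coboundary of a linear form on gl(m), and the        *)
(* cocycle identity is the Jacobi identity for the commutator.                *)
Require Import Defs.
From HB Require Import structures.
From mathcomp Require Import all_boot all_order all_algebra.
From mathcomp Require Import ring.

Set Implicit Arguments.
Unset Strict Implicit.
Unset Printing Implicit Defensive.

Import GRing.Theory.
Local Open Scope ring_scope.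

(** A bilinear map of the form [f (lie A B)], with [f] linear, is automatically a cocycle: the
    cyclic sum is [f] applied to the Jacobi sum, hence 0 ([coboundary_cocycle]). So it suffices to
    put the pairing in this form, with [f] being [two_rho_form] ([pairing_coboundary]). For sl,
    commutators are traceless. *)

Section Coboundary.
Variables (K : numFieldType) (m : nat).
Implicit Types A B C X : 'M[K]_m.

Lemma lie_linear_l k A B C : lie (k *: A + B) C = k *: lie A C + lie B C.
Proof.
rewrite /lie mulmxDl mulmxDr -scalemxAl -scalemxAr scalerBr.
by rewrite opprD addrACA.
Qed.

Lemma lie_skew A B : lie A B = - lie B A.
Proof. by rewrite /lie opprB. Qed.

Lemma lie_jacobi A B C :
  lie A (lie B C) + lie B (lie C A) + lie C (lie A B) = 0.
Proof.
rewrite /lie !mulmxBr !mulmxBl !mulmxA.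
apply/matrixP => i j; rewrite !mxE; ring.
Qed.

(** Stated for an arbitrary subspace [L] so that gl and sl are both instances. *)
Lemma coboundary_cocycle (L : {vspace 'M[K]_m}) (f : {linear 'M[K]_m -> K^o})
    (w : 'M[K]_m -> 'M[K]_m -> K) :
  (forall A B, w A B = f (lie A B)) -> lie_cocycle L w.
Proof.
move=> wE; have wl k A B C : w (k *: A + B) C = k * w A C + w B C.
  by rewrite !wE lie_linear_l linearP.
have ws A B : w A B = - w B A by rewrite !wE lie_skew linearN.
split=> [k A B C _ _ _ | k A B C _ _ _ | A B _ _ | A B C _ _ _] //.
  by rewrite ws wl opprD -mulrN -!ws.
by rewrite !wE -(linear0 f) -(lie_jacobi A B C) !linearD.
Qed.

Lemma lie_sl A B : lie A B \in sl K m.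
Proof. by rewrite mem_sl /lie linearB /= mxtrace_mulC subrr. Qed.

Lemma mxtrace_mul_delta i j A : \tr (A *m delta_mx i j) = A j i.
Proof.
rewrite /mxtrace (bigD1 j) //= big1 ?addr0 => [|k kj].
  rewrite mxE (bigD1 i) //= mxE !eqxx mulr1 big1 ?addr0 // => k ki.
  by rewrite mxE (negPf ki) mulr0.
by rewrite mxE big1 // => l _; rewrite mxE (negPf kj) andbF mulr0.
Qed.

Lemma mxtrace_mul2_delta i j k l A B :
  \tr (A *m delta_mx i j *m B *m delta_mx k l) = A l i * B j k.
Proof.
rewrite mxtrace_mul_delta -mulmxA mxE (bigD1 i) //= big1 ?addr0 => [|s si].
  congr (_ * _); rewrite mxE (bigD1 j) //= mxE !eqxx mul1r big1 ?addr0 // => s sj.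
  by rewrite mxE (negPf sj) andbF mul0r.
rewrite [X in _ * X]mxE big1 ?mulr0 // => t _.
by rewrite mxE (negPf si) mul0r.
Qed.

(** Of the four traces, two have cyclically adjacent matrix units, which merge into a diagonal unit;
    in the other two the units separate [A] from [B], and the trace factors into entries. *)
Lemma mxtrace_ad_delta i j A B :
  \tr (mxad (delta_mx i j) A *m mxad (delta_mx j i) B) =
  A j j * B i i + A i i * B j j - (A *m B) j j - (B *m A) i i.
Proof.
rewrite /mxad mulmxBl !mulmxBr !linearB /= !mulmxA.
have -> : \tr (delta_mx i j *m A *m delta_mx j i *m B) = A j j * B i i.
  by rewrite mxtrace_mulC !mulmxA mxtrace_mul2_delta mulrC.
have -> : \tr (delta_mx i j *m A *m B *m delta_mx j i) = (A *m B) j j.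
  rewrite mxtrace_mulC !mulmxA mul_delta_mx -mulmxA mxtrace_mulC.
  by rewrite mxtrace_mul_delta.
have -> : \tr (A *m delta_mx i j *m delta_mx j i *m B) = (B *m A) i i.
  rewrite mxtrace_mulC -(mulmxA A) mul_delta_mx mulmxA.
  by rewrite mxtrace_mul_delta.
by rewrite mxtrace_mul2_delta; ring.
Qed.

(** By cyclicity each summand is the diagonal entry [(A *m B) j j]; the free index [i] gives the
    factor [m]. *)
Lemma tens_tr_r_plus_l_r A B :
  tens_tr (r_plus_l_r (tens A B)) = \tr (A *m B) *+ m.
Proof.
rewrite /r_plus_l_r linear_sum /=.
rewrite -[X in _ *+ X]card_ord -sumr_const.
apply: eq_bigr => i _; rewrite linear_sum /=; apply: eq_bigr => j _.
rewrite tens_mapE tens_trE /= mxtrace_mulC mulmxA -(mulmxA B) mul_delta_mx.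
by rewrite mxtrace_mulC mulmxA mxtrace_mul_delta.
Qed.

Lemma tens_tr_r_plus_r_l A B :
  tens_tr (r_plus_r_l (tens A B)) = \tr (A *m B) *+ m.
Proof.
(* Here the summand is [(B *m A) i i], so the sum over [i] must be innermost to form a trace. *)
rewrite /r_plus_r_l exchange_big linear_sum mxtrace_mulC /=.
rewrite -[X in _ *+ X]card_ord -sumr_const; apply: eq_bigr => j _; rewrite linear_sum /=.
apply: eq_bigr => i _.
rewrite tens_mapE tens_trE /= mulmxA -(mulmxA A) mul_delta_mx.
by rewrite mxtrace_mulC mulmxA mxtrace_mul_delta.
Qed.

(* Since [e_i^j, e_j^i] = e_i^i - e_j^j, this is X |-> Tr (2 rho o X), where  *)
(* 2 rho is the sum of the positive coroots.                                  *)
Definition two_rho_form X : K^o :=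
  \sum_(i < m) \sum_(j < m | (i < j)%N) (X i i - X j j).

Fact two_rho_form_is_linear : linear two_rho_form.
Proof.
move=> k X Y; rewrite /two_rho_form scaler_sumr -big_split /=.
apply: eq_bigr => i _; rewrite scaler_sumr -big_split /=.
by apply: eq_bigr => j _; rewrite !mxE /GRing.scale /=; ring.
Qed.

HB.instance Definition _ :=
  GRing.isLinear.Build K 'M[K]_m K^o _ two_rho_form two_rho_form_is_linear.

(** The products of diagonal entries in [mxtrace_ad_delta] are symmetric in [i] and [j], so
    antisymmetrization cancels them and leaves commutator entries. *)
Lemma tens_tr_r_minus_ad_ad A B :
  tens_tr (r_minus_ad_ad (tens A B)) = two_rho_form (lie A B).
Proof.
rewrite /r_minus_ad_ad linear_sum; apply: eq_bigr => i _.
rewrite linear_sum; apply: eq_bigr => j _.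
rewrite linearB /= !tens_mapE !tens_trE !mxtrace_ad_delta /lie !mxE; ring.
Qed.

Lemma pairing_coboundary (b : {linear 'M[K]_(m * m) -> K^o}) A B :
  is_b b -> pairing b A B = two_rho_form (lie A B).
Proof.
move=> hb; rewrite /pairing hb linearD linearB linearN /=.
rewrite tens_tr_r_minus_ad_ad tens_tr_r_plus_l_r tens_tr_r_plus_r_l.
by rewrite subrK opprK.
Qed.

End Coboundary.

Theorem proposition36 (K : numFieldType) (m : nat)
    (b : {linear 'M[K]_(m * m) -> K^o}) (hb : is_b b) :
  [/\ lie_cocycle (gl K m) (pairing b),
      lie_subalgebra (sl K m)
    & lie_cocycle (sl K m) (pairing b)].
Proof.
by split=> [| A B _ _ |];
  [| exact: lie_sl |]; apply: coboundary_cocycle => A B;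
  apply: pairing_coboundary.
Qed.
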